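(* Suppose that for every $m\ge 2$ and every graph $H$ on $m$ vertices, setting $\ell=|D(H)|/2$, one has $$\lambda_2(H)\ \ge\ \frac{m-\ell+1-\sqrt{(m-\ell+1)^2-4(m-2\ell)}}{2}.$$ Then for every graph $G$ on $n\ge 3$ vertices, $$\lambda_2(G)+\lambda_2(G^c)\ \ge\ 1.$$
   Context: Graphs are finite, simple and undirected; $G^c$ denotes the complement of $G$. The Laplacian of a graph on $n$ vertices is $L=\Delta-A$, where $\Delta$ is the diagonal matrix of degrees and $A$ is the adjacency matrix; its eigenvalues are listed as $0=\lambda_1(G)\le\lambda_2(G)\le\cdots\le\lambda_n(G)$, so $\lambda_2(G)$ (the algebraic connectivity) is the second smallest eigenvalue counted with multiplicity. $d(x,v)$ denotes graph distance (equal to $\infty$ if $x,v$ lie in different components), and $D(G)=\{v\in V(G): \text{there is some } x\in V(G)\text{ with } d(x,v)\ge 3\}$. *)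

(* Defs.v *)
From mathcomp Require Import all_boot all_order all_algebra.
From mathcomp Require Import polyrcf.
Set Implicit Arguments.
Unset Strict Implicit.
Unset Printing Implicit Defensive.
Import Order.TTheory GRing.Theory Num.Theory.
Local Open Scope ring_scope.

Record sgraph (T : finType) := SGraph {
  adj :> rel T;
  adj_sym : symmetric adj;
  adj_irr : irreflexive adj
}.

Section Graphs.
Variable T : finType.
Implicit Types (G : sgraph T) (x y v : T).

Definition compl_rel G : rel T := [rel x y | (x != y) && ~~ G x y].

Lemma compl_sym G : symmetric (compl_rel G).
Proof. by move=> x y; rewrite /compl_rel /= eq_sym adj_sym. Qed.

Lemma compl_irr G : irreflexive (compl_rel G).
Proof. by move=> x; rewrite /compl_rel /= eqxx. Qed.

Definition compl G : sgraph T := SGraph (compl_sym G) (compl_irr G).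

Definition walk G (k : nat) x y : bool :=
  [exists p : k.-tuple T, path G x p && (last x p == y)].

(* [None] stands for an infinite distance.  Looking at lengths below #|T| is
   enough, since a shortest walk does not repeat a vertex. *)
Definition dist G x y : option nat :=
  let k := find (fun k => walk G k x y) (iota 0 #|T|) in
  if (k < #|T|)%N then Some k else None.

Definition dist_ge G (k : nat) x y : bool :=
  if dist G x y is Some d then (k <= d)%N else true.

Definition far_set G : {set T} := [set v | [exists x, dist_ge G 3 x v]].

Definition deg G x : nat := #|[set y | G x y]|.

(* Rows and columns are indexed by the enumeration of the vertices. *)
Definition laplacian (R : pzRingType) G : 'M[R]_#|T| :=
  diag_mx (\row_i (deg G (enum_val i))%:R)
  - \matrix_(i, j) (G (enum_val i) (enum_val j))%:R.

End Graphs.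

Section Spectrum.
Variable R : rcfType.

(* [rootsR p] lists the distinct roots of [p] in [R] in increasing order, and
   [mup x p] is the multiplicity of [x] in [p].  For a symmetric matrix [A] all
   [n] eigenvalues lie in [R], and algebraic and geometric multiplicities
   coincide, so that [eigenvalues A] has size [n]. *)
Definition eigenvalues n (A : 'M[R]_n) : seq R :=
  flatten [seq nseq (mup x (char_poly A)) x | x <- rootsR (char_poly A)].

(* The paper's [lambda_k], with [k] counted from 1. *)
Definition lambda (T : finType) (k : nat) (G : sgraph T) : R :=
  (eigenvalues (laplacian R G))`_k.-1.

End Spectrum.
Arguments lambda R {T} k G.

(* Main.v *)
Require Import Defs.
From mathcomp Require Import all_boot all_order all_algebra.
From mathcomp Require Import ring lra.
Import Order.TTheory GRing.Theory Num.Theory.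
Local Open Scope ring_scope.

(** No vertex lies in both [D(G)] and [D(G^c)]: if [d(x,v) >= 3] in [G] and
    [d(y,v) >= 3] in [G^c], then [y] is [G]-adjacent to [v], while [x], which is
    not, must be [G]-adjacent to [y]; so [d(x,v) <= 2].  Hence the two values
    [l, l'] satisfy [l + l' <= n/2].

    The assumed bound [t] for [l] is the smaller root of
    [q_l(x) = (1 - x)(n - x) - l(2 - x)], and it lies in [[0,1]].  From
    [q_l(t) = 0] and [l' <= n/2 - l] one gets
    [(2 - t) q_l'(1 - t) >= (3n - 6) t (1 - t) / 2 >= 0], so [1 - t], which is
    below the vertex of [q_l'], is at most the smaller root of [q_l']. *)

(** [find] stops at the first length that carries a walk, so a walk of length [k < #|T|] makes the
    distance finite and at most [k]. *)
Lemma dist_ge_walkF (T : finType) (G : sgraph T) (d k : nat) (x y : T) :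
  dist_ge G d x y -> (k < d)%N -> (k < #|T|)%N -> walk G k x y = false.
Proof.
move=> far lt_kd lt_kT; case walk_k: (walk G k x y) => //.
set a := fun i => walk G i x y.
have le_find : (find a (iota 0 #|T|) <= k)%N.
  rewrite leqNgt; apply/negP => /(before_find 0).
  by rewrite nth_iota // add0n /a walk_k.
move: far; rewrite /dist_ge /dist -/a (leq_ltn_trans le_find lt_kT).
by rewrite leqNgt (leq_ltn_trans le_find lt_kd).
Qed.

(** Walks of length 0, 1 and 2 are excluded in turn; [3 <= #|T|] keeps these lengths in the range
    searched by [dist]. *)
Lemma dist_ge3 (T : finType) (G : sgraph T) (x y : T) :
  (3 <= #|T|)%N -> dist_ge G 3 x y ->
  [/\ x != y, ~~ G x y & forall z, ~~ (G x z && G z y)].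
Proof.
move=> T3 far.
have noWalk p : (size p < 3)%N -> path G x p -> last x p != y.
  move=> p3 xp; apply/negP => lastp.
  have := dist_ge_walkF _ _ _ _ _ _ far p3 (leq_trans p3 T3).
  by move/existsP; apply; exists (in_tuple p); rewrite xp.
split; first exact: (noWalk [::]).
  by apply/negP => xy; have := noWalk [:: y] isT; rewrite /= xy eqxx; move/(_ isT).
move=> z; apply/negP => xzy.
by have := noWalk [:: z; y] isT; rewrite /= andbT eqxx; move/(_ xzy).
Qed.

Lemma far_set_compl_disjoint (T : finType) (G : sgraph T) :
  (3 <= #|T|)%N -> [disjoint far_set G & far_set (compl G)].
Proof.
move=> T3; apply/pred0P => v /=; apply/negP; rewrite !inE.
case/andP=> /existsP[x /(dist_ge3 _ _ _ _ T3)[xv nGxv noz]].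
case/existsP=> y /(dist_ge3 _ _ _ _ T3)[yv].
(* In the complement [x] is adjacent to [v], hence not to [y]: either [y = x] or [G y x]. *)
rewrite /= /compl_rel /= yv negbK => Gyv /(_ x); have := noz y.
rewrite Gyv andbT xv nGxv /= andbT negb_and !negbK => nGxy.
rewrite adj_sym (negPf nGxy) orbF => /eqP eq_yx.
by rewrite -eq_yx Gyv in nGxv.
Qed.

Lemma lower_root_sum_ge1 (R : rcfType) (n l l' : R) :
  2 <= n -> 0 <= l -> 0 <= l' -> l + l' <= n / 2 ->
  1 <= (n - l + 1 - Num.sqrt ((n - l + 1) ^+ 2 - 4 * (n - 2 * l))) / 2
     + (n - l' + 1 - Num.sqrt ((n - l' + 1) ^+ 2 - 4 * (n - 2 * l'))) / 2.
Proof.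
move=> n2 l0 l'0 ll'.
set D := (n - l + 1) ^+ 2 - _; set D' := (n - l' + 1) ^+ 2 - _.
(* This form shows [0 <= D] and bounds its root from below, whence [t <= 1]. *)
have DE : D = (n - l - 1) ^+ 2 + 4 * l by rewrite /D; ring.
have s2 : Num.sqrt D ^+ 2 = D.
  by rewrite sqr_sqrtr // DE addr_ge0 ?sqr_ge0 ?mulr_ge0.
have s_ge : n - l - 1 <= Num.sqrt D.
  rewrite -[leLHS]ger0_norm; last lra.
  by rewrite -sqrtr_sqr ler_wsqrtr // DE lerDl mulr_ge0.
have s_le : Num.sqrt D <= n - l + 1.
  rewrite -[leRHS]ger0_norm; last lra.
  by rewrite -sqrtr_sqr ler_wsqrtr // /D; lra.
set t := (n - l + 1 - Num.sqrt D) / 2.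
have t0 : 0 <= t by rewrite /t; lra.
have t1 : t <= 1 by rewrite /t; lra.
have sE : Num.sqrt D = n - l + 1 - 2 * t by rewrite /t; field.
have root_t : (1 - t) * (n - t) = l * (2 - t).
  by move: s2; rewrite sE /D; lra.
have q_ge0 : 0 <= t * (n - 1 + t) - l' * (1 + t).
  (* The factor [2 - t] lets [root_t] eliminate [l]. *)
  rewrite -(pmulr_rge0 _ (_ : 0 < 2 - t)); last lra.
  have -> : (2 - t) * (t * (n - 1 + t) - l' * (1 + t)) =
      (3 * n - 6) / 2 * (t * (1 - t))
      + (n / 2 - l - l') * ((1 + t) * (2 - t)).
    have -> : (n / 2 - l - l') * ((1 + t) * (2 - t)) =
        (n / 2 - l') * ((1 + t) * (2 - t)) - (1 + t) * (l * (2 - t)) by ring.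
    by rewrite -root_t; field.
  by rewrite addr_ge0 // !mulr_ge0 //; lra.
(* Restates that [1 - t] is at most the smaller root for [l']; squaring reduces it to [q_ge0]. *)
have : Num.sqrt D' <= n - l' + 1 - 2 * (1 - t).
  rewrite -[leRHS]ger0_norm; last lra.
  rewrite -sqrtr_sqr ler_wsqrtr // -subr_ge0.
  have -> : (n - l' + 1 - 2 * (1 - t)) ^+ 2 - D' =
      4 * (t * (n - 1 + t) - l' * (1 + t)) by rewrite /D'; ring.
  by rewrite mulr_ge0.
lra.
Qed.

Theorem theorem2p2 (R : rcfType)
  (hyp : forall (m : nat) (U : finType) (H : sgraph U),
     (2 <= m)%N -> #|U| = m ->
     let l : R := #|far_set H|%:R / 2 in
     is_true (lambda R 2 H >=
       (m%:R - l + 1 - Num.sqrt ((m%:R - l + 1) ^+ 2 - 4 * (m%:R - 2 * l))) / 2))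
  (n : nat) (V : finType) (G : sgraph V) (n_ge3 : (3 <= n)%N) (cardV : #|V| = n) :
  lambda R 2 G + lambda R 2 (compl G) >= 1.
Proof.
have n2 : (2 <= n)%N by exact: ltnW.
apply: le_trans (lerD (hyp n V G n2 cardV) (hyp n V (compl G) n2 cardV)).
apply: lower_root_sum_ge1; rewrite ?divr_ge0 ?ler0n ?ler_nat //.
(* What remains is [l + l' <= n / 2], from disjointness of the far sets. *)
rewrite -mulrDl ler_pM2r ?invr_gt0 // -natrD ler_nat.
have := far_set_compl_disjoint _ G; rewrite cardV => /(_ n_ge3).
rewrite -leq_card_setU => /eqP <-; rewrite -cardV.
exact: max_card.
Qed.
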